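(* Let $a,b,p,q$ be complex numbers with $p\neq 0$, $q\neq 0$, and let $(W_j)$, $(V_j)$ be as defined in the context. If $n$ is a non-negative integer and $r$ and $t$ are any integers, then \[ \sum_{k = 0}^n \binom nk^3 q^{rk} W_{r(n - 2k) + t} = W_t \sum_{k = 0}^n \binom{n + k}{2k}\binom{2k}{k}\binom{n - k}{k}q^{rk} V_r^{n - 2k}. \]
   Context: The Horadam sequence $W_j=W_j(a,b;p,q)$ is defined by $W_0=a$, $W_1=b$, $W_j=pW_{j-1}-qW_{j-2}$ for $j\ge 2$, and extended to negative indices by $W_{-j}=\frac{1}{q}(pW_{-j+1}-W_{-j+2})$. The Lucas sequence of the second kind is $V_j=W_j(2,p;p,q)$ (so $V_0=2$, $V_1=p$). Binomial coefficients $\binom{N}{k}$ with $k>N\ge 0$ are $0$. *)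

(* Defs.v *)
From HB Require Import structures.
From mathcomp Require Import all_boot all_order all_algebra.
From mathcomp Require Import reals complex.

Set Implicit Arguments.
Unset Strict Implicit.
Unset Printing Implicit Defensive.

Import Order.TTheory GRing.Theory Num.Theory.
Local Open Scope ring_scope.

Fixpoint horadam_nat (F : fieldType) (a b p q : F) (j : nat) : F :=
  match j with
  | 0 => a
  | j1.+1 =>
    match j1 with
    | 0 => b
    | j2.+1 => p * horadam_nat a b p q j1 - q * horadam_nat a b p q j2
    end
  end.

(* [horadam_opp a b p q j] is W_{-j}. *)
Fixpoint horadam_opp (F : fieldType) (a b p q : F) (j : nat) : F :=
  match j with
  | 0 => a
  | j1.+1 =>
    match j1 with
    | 0 => q^-1 * (p * a - b)
    | j2.+1 =>
      q^-1 * (p * horadam_opp a b p q j1 - horadam_opp a b p q j2)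
    end
  end.

(* [Negz n] is the integer - (n + 1). *)
Definition horadam (F : fieldType) (a b p q : F) (j : int) : F :=
  match j with
  | Posz n => horadam_nat a b p q n
  | Negz n => horadam_opp a b p q n.+1
  end.

Definition lucasV (F : fieldType) (p q : F) (j : int) : F :=
  horadam 2 p p q j.

Lemma horadam0 (F : fieldType) (a b p q : F) : horadam a b p q 0 = a.
Proof. by []. Qed.

Lemma horadam1 (F : fieldType) (a b p q : F) : horadam a b p q 1 = b.
Proof. by []. Qed.

Lemma horadam_rec (F : fieldType) (a b p q : F) (j : int) : 2 <= j ->
  horadam a b p q j =
    p * horadam a b p q (j - 1) - q * horadam a b p q (j - 2).
Proof.
case: j => [[|[|n]]|n] // _.
have -> : n.+2%:Z - 1 = n.+1%:Z by rewrite -addn1 PoszD addrK.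
by have -> : n.+2%:Z - 2 = n%:Z by rewrite -addn2 PoszD addrK.
Qed.

Lemma horadam_opp_rec (F : fieldType) (a b p q : F) (j : int) : 1 <= j ->
  horadam a b p q (- j) =
    q^-1 * (p * horadam a b p q (- j + 1) - horadam a b p q (- j + 2)).
Proof.
have hN n : horadam a b p q (- n%:Z) = horadam_opp a b p q n by case: n.
case: j => [[|[|n]]|n] // _.
have -> : - n.+2%:Z + 1 = - n.+1%:Z by rewrite -addn1 PoszD opprD addrNK.
have -> : - n.+2%:Z + 2 = - n%:Z by rewrite -addn2 PoszD opprD addrNK.
by rewrite !hN.
Qed.

(* Main.v *)
(** Exchanging k with n - k and using W_(t+m) + q^m W_(t-m) = V_m W_t shows
    that twice the left-hand side is W_t times the sum of
    'C(n,k)^3 q^(rk) V_(r(n-2k)). Writing p = x + y and q = x y, so that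
    V_j = x^j + y^j even when x = y, the claim becomes MacMahon's expansion
    of the sum of 'C(n,k)^3 X^(n-k) Y^k in X Y and X + Y, at X = x^r and
    Y = y^r. Comparing coefficients there leaves Riordan's identity
    'C(x,a) 'C(x,b) = \sum_k 'C(x+k,a+b) 'C(a,k) 'C(b,k), which is
    Vandermonde's convolution applied three times. *)
Require Import Defs.
From HB Require Import structures.
From mathcomp Require Import all_boot all_order all_algebra.
From mathcomp Require Import reals complex.
From mathcomp Require Import zify ring.

Set Implicit Arguments.
Unset Strict Implicit.
Unset Printing Implicit Defensive.

Import Order.TTheory GRing.Theory Num.Theory.
Local Open Scope ring_scope.

Lemma mul_bin_trinomial (n m j : nat) : (j <= m)%N ->
  ('C(n, m) * 'C(m, j) = 'C(n, j) * 'C(n - j, m - j))%N.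
Proof.
move=> jm; case: (leqP m n) => [mn|nm]; last first.
  rewrite bin_small // mul0n; case: (leqP j n) => [jn|nj].
    by rewrite (@bin_small (n - j)) ?muln0 //; lia.
  by rewrite bin_small.
have := bin_fact mn; have := bin_fact jm; have := bin_fact (leq_trans jm mn).
have := @bin_fact (n - j) (m - j) (leq_sub2r j mn).
rewrite (_ : n - j - (m - j) = n - m)%N; last lia.
move=> h1 h2 h3 h4.
have f0 : (0 < j`! * (m - j)`! * (n - m)`!)%N by rewrite !muln_gt0 !fact_gt0.
by apply/eqP; rewrite -(eqn_pmul2r f0); apply/eqP; nia.
Qed.

(** Terms with j > N >= k vanish. A bound N not tied to i lets the double sum in [mul_bin_Riordan]
    run over a square, so that it can be exchanged. *)
Lemma Vandermonde_trunc (k l i N : nat) : (k <= N <= i)%N ->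
  (\sum_(j < N.+1) 'C(k, j) * 'C(l, i - j) = 'C(k + l, i))%N.
Proof.
case/andP=> kN Ni; rewrite -binomial.Vandermonde.
rewrite -!(big_mkord xpredT (fun j => 'C(k, j) * 'C(l, i - j)))%N.
rewrite [RHS](@big_cat_nat _ _ _ N.+1) //=.
rewrite [X in (_ = _ + X)%N]big_nat [X in (_ = _ + X)%N]big1 ?addn0 // => j.
by case/andP=> Nj _; rewrite bin_small // (leq_ltn_trans kN).
Qed.

(** After the shift k -> k + j, trinomial revision pulls 'C(a,j) out of 'C(a,k+j) 'C(k+j,j) and
    leaves 'C(a-j,k). With 'C(b,k+j) = 'C(b,b-j-k), the sum is a Vandermonde convolution. *)
Lemma sum_bin3 (a b j : nat) : (j <= b)%N ->
  (\sum_(k < b.+1) 'C(k, j) * ('C(a, k) * 'C(b, k))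
     = 'C(a, j) * 'C(a + b - j, b - j))%N.
Proof.
move=> jb.
rewrite -(big_mkord xpredT (fun k => 'C(k, j) * ('C(a, k) * 'C(b, k))))%N.
rewrite (@big_cat_nat _ _ _ j) //=; last exact: leqW.
rewrite big_nat big1 ?add0n; last first.
  by move=> k /andP[_ kj]; rewrite bin_small.
rewrite -{1}[j]add0n big_addn subSn // big_mkord.
case: (leqP j a) => [ja|aj]; last first.
  rewrite (@bin_small a) // big1 // => k _.
  by rewrite (@bin_small a) ?mul0n ?muln0 // (leq_trans aj) ?leq_addl.
rewrite -addnBAC // -binomial.Vandermonde big_distrr /=.
apply: eq_bigr => -[k /=]; rewrite ltnS => kb _.
rewrite mulnA [('C(_, j) * _)%N]mulnC mul_bin_trinomial ?leq_addl // addnK.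
by rewrite -mulnA -(@bin_sub b (k + j)) ?[(k + j)%N]addnC ?subnDA; lia.
Qed.

Lemma mul_bin_Riordan (x a b : nat) : (a <= x)%N ->
  (\sum_(k < b.+1) 'C(x + k, a + b) * ('C(a, k) * 'C(b, k))
     = 'C(x, a) * 'C(x, b))%N.
Proof.
move=> ax.
transitivity (\sum_(k < b.+1) \sum_(j < b.+1)
  'C(x, a + b - j) * ('C(k, j) * ('C(a, k) * 'C(b, k))))%N.
  apply: eq_bigr => -[k /= kb] _.
  rewrite addnC -(@Vandermonde_trunc k x (a + b) b) ?leq_addl ?andbT //.
  by rewrite big_distrl /=; apply: eq_bigr => j _; ring.
rewrite exchange_big /= -[in 'C(x, b)](subnKC ax) -binomial.Vandermonde.
rewrite big_distrr /=.
apply: eq_bigr => -[j /=]; rewrite ltnS => jb _.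
(* What remains for each j is 'C(x,a+b-j) 'C(a+b-j,b-j) = 'C(x,a) 'C(x-a,b-j), trinomial revision
   once the second factor is read as 'C(a+b-j,a). *)
rewrite -big_distrr /= sum_bin3 // mulnCA [RHS]mulnCA; congr (_ * _)%N.
have e : (a + b - j - a = b - j)%N by lia.
have ae : (a <= a + b - j)%N by lia.
by rewrite -e -mul_bin_trinomial // bin_sub.
Qed.

(** Riordan's identity at x = n, a = m, b = n - m; its right side is 'C(n,m) ^ 2 by symmetry. *)
Lemma sum_bin_MacMahon_coef (n m : nat) : (m <= n)%N ->
  (\sum_(0 <= k < n.+1) 'C(n, m) * ('C(n + k, n) * ('C(m, k) * 'C(n - m, k)))
     = 'C(n, m) ^ 3)%N.
Proof.
move=> mn; rewrite -big_distrr /= (@big_cat_nat _ _ _ (n - m).+1) //=; last lia.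
rewrite [X in (_ + X)%N]big_nat [X in (_ + X)%N]big1 ?addn0; last first.
  by move=> k /andP[nmk _]; rewrite (@bin_small (n - m)) ?muln0.
rewrite big_mkord; have := mul_bin_Riordan (n - m) mn.
by rewrite subnKC // => ->; rewrite bin_sub // !expnS expn0 muln1.
Qed.

(** This is (n+k)! / (k!^3 (n-2k)!) for 2k <= n, and 0 otherwise. *)
Definition MacMahon_coef (n k : nat) : nat :=
  ('C(n + k, 2 * k) * 'C(2 * k, k) * 'C(n - k, k))%N.

(** Both sides equal (n+k)! / (k!^3 (m-k)! (n-m-k)!). *)
Lemma MacMahon_coef_bin (n m k : nat) : (k <= m <= n - k)%N ->
  (MacMahon_coef n k * 'C(n - 2 * k, m - k)
     = 'C(n, m) * ('C(n + k, n) * ('C(m, k) * 'C(n - m, k))))%N.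
Proof.
case/andP=> km mnk; rewrite /MacMahon_coef.
have h1 := @bin_fact (n + k) (2 * k) ltac:(lia).
have h2 := @bin_fact (2 * k) k ltac:(lia).
have h3 := @bin_fact (n - k) k ltac:(lia).
have h4 := @bin_fact (n - 2 * k) (m - k) ltac:(lia).
have h5 := @bin_fact n m ltac:(lia).
have h6 := @bin_fact (n + k) n ltac:(lia).
have h7 := @bin_fact m k km.
have h8 := @bin_fact (n - m) k ltac:(lia).
rewrite (_ : n + k - 2 * k = n - k)%N in h1; last lia.
rewrite (_ : 2 * k - k = k)%N in h2; last lia.
rewrite (_ : n - k - k = n - 2 * k)%N in h3; last lia.
rewrite (_ : n - 2 * k - (m - k) = n - m - k)%N in h4; last lia.
rewrite (_ : n + k - n = k)%N in h6; last lia.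
have f0 : (0 < k`! * k`! * k`! * (m - k)`! * (n - m - k)`!)%N.
  by rewrite !muln_gt0 !fact_gt0.
apply/eqP; rewrite -(eqn_pmul2r f0); apply/eqP.
transitivity ((n + k)`!).
  rewrite -h1 -h2 -h3 -h4; ring.
rewrite -h6 -h5 -h7 -h8; ring.
Qed.

Lemma MacMahon (R : comNzRingType) (x y : R) (n : nat) :
  \sum_(0 <= k < n.+1) 'C(n, k)%:R ^+ 3 * (x ^+ k * y ^+ (n - k))
  = \sum_(0 <= k < n.+1)
      (MacMahon_coef n k)%:R * (x * y) ^+ k * (x + y) ^+ (n - 2 * k).
Proof.
transitivity (\sum_(0 <= k < n.+1) \sum_(0 <= m < n.+1)
    ('C(n, m) * ('C(n + k, n) * ('C(m, k) * 'C(n - m, k))))%:R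
      * (x ^+ m * y ^+ (n - m))).
  rewrite exchange_big_nat /= !big_mkord; apply: eq_bigr => -[m /= mn] _.
  by rewrite -mulr_suml -natr_sum sum_bin_MacMahon_coef // natrX.
rewrite !big_mkord; apply: eq_bigr => -[k /=]; rewrite ltnS => kn _.
(* Only k <= m <= n - k contributes to the inner sum. If 2k > n there is no such m; otherwise m = i
   + k turns the sum into the binomial expansion of (x + y) ^ (n - 2k). *)
case: (leqP (2 * k) n) => [kn2|nk2]; last first.
  rewrite /MacMahon_coef (@bin_small (n - k)); last lia.
  rewrite muln0 !mul0r big_nat big1 // => m /andP[_ mn].
  case: (ltnP m k) => mk; first by rewrite (bin_small mk) mul0n !muln0 mul0r.
  by rewrite (@bin_small (n - m)) ?muln0 ?mul0r //; lia.
rewrite (@big_cat_nat _ _ _ k) //=; last lia.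
rewrite big_nat big1 ?add0r; last first.
  by move=> m /andP[_ mk]; rewrite (bin_small mk) mul0n !muln0 mul0r.
rewrite (@big_cat_nat _ _ _ (n - k).+1) //=; try lia.
rewrite [X in _ + X]big_nat [X in _ + X]big1 ?addr0; last first.
  by move=> m /andP[mk mn]; rewrite (@bin_small (n - m)) ?muln0 ?mul0r //; lia.
rewrite -{1}[k]add0n big_addn [in RHS]addrC exprDn mulr_sumr big_mkord.
rewrite (_ : (n - k).+1 - k = (n - 2 * k).+1)%N; last lia.
apply: eq_bigr => -[i /=]; rewrite ltnS => ik _.
rewrite -MacMahon_coef_bin; last lia.
rewrite addnK natrM (_ : n - (i + k) = k + (n - 2 * k - i))%N; last lia.
rewrite -mulr_natl !exprD exprMn; ring.
Qed.

Lemma horadam_recz (F : fieldType) (a b p q : F) (j : int) : q != 0 ->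
  horadam a b p q (j + 2) =
    p * horadam a b p q (j + 1) - q * horadam a b p q j.
Proof.
move=> q0; case: (lerP 0 j) => [j0|j0].
  rewrite horadam_rec; last lia.
  by congr (_ * horadam _ _ _ _ _ - _ * horadam _ _ _ _ _); lia.
have := @horadam_opp_rec F a b p q (- j) ltac:(lia).
by rewrite opprK => ->; rewrite mulVKf //; ring.
Qed.

(** Induction runs both ways on pairs of consecutive values, the downward one cancelling q. The next
    two lemmas thereby reduce to indices 0 and 1. *)
Lemma recz_eq (F : fieldType) (p q : F) (f g : int -> F) : q != 0 ->
  (forall j, f (j + 2) = p * f (j + 1) - q * f j) ->
  (forall j, g (j + 2) = p * g (j + 1) - q * g j) ->
  f 0 = g 0 -> f 1 = g 1 -> f =1 g.
Proof.
move=> q0 fr gr e0 e1.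
have P (n : nat) : f n = g n /\ f (n%:Z + 1) = g (n%:Z + 1).
  elim: n => [|n [h1 h2]]; first by rewrite add0r.
  have -> : n.+1%:Z = n%:Z + 1 by lia.
  by split=> //; rewrite -addrA fr gr h1 h2.
have N (n : nat) : f (- n%:Z) = g (- n%:Z) /\ f (- n%:Z + 1) = g (- n%:Z + 1).
  elim: n => [|n [h1 h2]]; first by rewrite oppr0 add0r.
  have e : - n.+1%:Z + 1 = - n%:Z by lia.
  have e' : - n.+1%:Z + 2 = - n%:Z + 1 by lia.
  rewrite e; split=> //; apply: (mulfI q0).
  have := fr (- n.+1%:Z); have := gr (- n.+1%:Z); rewrite e e' h1 h2 => -> /eqP.
  by rewrite (inj_eq (addrI _)) eqr_opp => /eqP ->.
move=> j; case: (lerP 0 j) => [/gez0_abs <-|/ltz0_abs e]; first exact: (P _).1.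
by rewrite -[j]opprK -e; exact: (N _).1.
Qed.

Lemma lucasV_roots (F : fieldType) (x y : F) (j : int) : x * y != 0 ->
  lucasV (x + y) (x * y) j = x ^ j + y ^ j.
Proof.
move=> q0; have /andP[x0 y0] : (x != 0) && (y != 0).
  by rewrite -negb_or -mulf_eq0.
move: j; apply: (recz_eq q0) => [j|j||] //; first exact: horadam_recz.
by rewrite !expfzDr // !expr1z; ring.
Qed.

Lemma horadam_addsub (F : fieldType) (a b p q : F) (t m : int) : q != 0 ->
  horadam a b p q (t + m) + q ^ m * horadam a b p q (t - m)
  = lucasV p q m * horadam a b p q t.
Proof.
move=> q0; move: m; apply: (recz_eq (p := p) q0) => [j|j||].
- rewrite addrA horadam_recz // (addrA t j 1).
  rewrite (expfzDr j 2 q0) (expfzDr j 1 q0) expr1z -exprnP.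
  (* The recurrence for W read backwards; the factor q ^ j restores its forward form. *)
  have := @horadam_recz F a b p q (t - (j + 2)) q0.
  rewrite (_ : t - (j + 2) + 2 = t - j); last lia.
  rewrite (_ : t - (j + 2) + 1 = t - (j + 1)); last lia.
  by move=> ->; ring.
- by rewrite /lucasV horadam_recz //; ring.
- by rewrite /lucasV horadam0 addr0 expr0z; ring.
- have := @horadam_recz F a b p q (t - 1) q0.
  rewrite (_ : t - 1 + 2 = t + 1); last lia.
  by rewrite subrK /lucasV horadam1 expr1z => ->; ring.
Qed.

Lemma sum_bin3_horadam (F : fieldType) (a b x y : F) (n : nat) (r t : int) :
    x * y != 0 -> 2 != 0 :> F ->
  \sum_(0 <= k < n.+1)
     'C(n, k)%:R ^+ 3 * (x * y) ^ (r * k%:Z)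
       * horadam a b (x + y) (x * y) (r * (n%:Z - 2 * k%:Z) + t)
  = horadam a b (x + y) (x * y) t *
    \sum_(0 <= k < n.+1)
      'C(n, k)%:R ^+ 3 * ((x ^ r) ^+ k * (y ^ r) ^+ (n - k)).
Proof.
move=> q0 two0; have /andP[x0 y0] : (x != 0) && (y != 0).
  by rewrite -negb_or -mulf_eq0.
have dbl z : 2 * z = z + z :> F by ring.
(* Each side is added to its own reversal, so that the terms k and n - k can be compared
   pairwise. *)
apply: (mulfI two0); rewrite !dbl -mulrDr.
rewrite [X in _ + X = _]big_nat_rev [X in _ = _ * (_ + X)]big_nat_rev /=.
rewrite -!big_split /= mulr_sumr.
rewrite !big_mkord; apply: eq_bigr => -[k /=]; rewrite ltnS => kn _.
rewrite add0n subSS bin_sub // subKn //.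
set m := r * (n%:Z - 2 * k%:Z).
rewrite (_ : r * (n%:Z - 2 * (n - k)%N%:Z) + t = t - m); last first.
  by rewrite /m -subzn //; ring.
rewrite (_ : r * (n - k)%N%:Z = r * k%:Z + m); last first.
  by rewrite /m -subzn //; ring.
rewrite expfzDr // [m + t]addrC -!mulrA -!mulrDr horadam_addsub //.
have e (z : F) : z != 0 -> z ^ (r * k%:Z) * z ^ m = (z ^ r) ^+ (n - k).
  move=> z0; rewrite -expfzDr // exprnP exprz_exp -subzn // /m.
  by congr (_ ^ _); ring.
have e' (z : F) : (z ^ r) ^+ k = z ^ (r * k%:Z) by rewrite exprnP exprz_exp.
rewrite lucasV_roots // expfzMl -!e // !e'; ring.
Qed.

Theorem theorem59 (R : realType) (a b p q : R[i]) (hp : p != 0) (hq : q != 0)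
    (n : nat) (r t : int) :
  \sum_(0 <= k < n.+1)
     'C(n, k)%:R ^+ 3 * q ^ (r * k%:Z)
       * horadam a b p q (r * (n%:Z - 2 * k%:Z) + t)
  = horadam a b p q t *
    \sum_(0 <= k < n.+1)
       'C(n + k, 2 * k)%:R * 'C(2 * k, k)%:R * 'C(n - k, k)%:R
         * q ^ (r * k%:Z) * lucasV p q r ^ (n%:Z - 2 * k%:Z).
Proof.
(* x and y are the roots of z^2 - p z + q, from the quadratic formula. *)
pose d : R[i] := sqrtC (p ^+ 2 - 4 * q).
pose x := (p + d) / 2; pose y := (p - d) / 2.
have ep : p = x + y by rewrite /x /y; field.
have eq_ : q = x * y.
  have := sqrtCK (p ^+ 2 - 4 * q); rewrite -/d => ed.
  have -> : x * y = (p ^+ 2 - d ^+ 2) / 4 by rewrite /x /y; field.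
  by rewrite ed; field.
rewrite ep eq_ in hq *; rewrite sum_bin3_horadam ?pnatr_eq0 //; congr (_ * _).
rewrite MacMahon lucasV_roots // !big_mkord.
apply: eq_bigr => -[k /=]; rewrite ltnS => kn _.
rewrite /MacMahon_coef !natrM -expfzMl -exprz_exp -exprnP.
(* For 2k > n the exponent of V_r is a negative integer here but truncates to 0 in [MacMahon]; the
   factor 'C(n-k,k) = 0 kills both terms. *)
case: (leqP (2 * k) n) => [kn2|nk2]; last first.
  by rewrite (@bin_small (n - k)) ?mulr0 ?mul0r //; lia.
by rewrite (_ : n%:Z - 2 * k%:Z = (n - 2 * k)%N) //; lia.
Qed.
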